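(* Let $h$ and $n$ be positive integers. If $n \geq \exp(h^2)$, then $$\zeta(h,n) \leq n^{1/h}\left(\frac{h}{e} + 2.32\,\log\log n + o(h)\right),$$ where $o(h)$ denotes a quantity depending only on $h$ whose quotient by $h$ tends to $0$ as $h\to\infty$. That is, there is a function $\varepsilon:\mathbb{Z}_{>0}\to\mathbb{R}$ with $\varepsilon(h)/h\to 0$ as $h\to\infty$ such that for all positive integers $h, n$ with $n\ge \exp(h^2)$ one has $\zeta(h,n)\le n^{1/h}\left(h/e+2.32\log\log n+\varepsilon(h)\right)$.
   Context: For a set $\mathcal{A}$ of non-negative integers and a positive integer $h$, $h\mathcal{A}$ denotes the set of all sums of $h$ elements of $\mathcal{A}$, repetition of elements allowed. For a non-negative integer $n$, $[0,n]$ denotes the set of integers $\{0,1,\dots,n\}$. A set $\mathcal{A}$ of non-negative integers is called an $h$-basis (additive basis of order $h$) of $[0,n]$ if $h\mathcal{A}\supseteq[0,n]$. The quantity $\zeta(h,n)$ is the minimal cardinality $|\mathcal{A}|$ among all $h$-bases $\mathcal{A}$ of $[0,n]$. Here $\log$ is the natural logarithm and $e$ is its base. *)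

(* Defs.v *)
From HB Require Import structures.
From mathcomp Require Import all_boot all_order all_algebra finmap.
From mathcomp Require Import all_classical all_reals all_analysis.

Set Implicit Arguments.
Unset Strict Implicit.
Unset Printing Implicit Defensive.

Import Order.TTheory GRing.Theory Num.Theory.

Local Open Scope classical_set_scope.
Local Open Scope nat_scope.

Definition sumset (h : nat) (A : set nat) : set nat :=
  [set m | exists2 a : 'I_h -> nat, forall i, A (a i) & m = \sum_(i < h) a i].

Definition is_basis (h n : nat) (A : set nat) : Prop :=
  [set m | m <= n] `<=` sumset h A.

(* Finite sets suffice for the minimum: [0, n] is a finite h-basis of itself
   when 0 < h. *)
Definition basis_card (h n : nat) : set nat :=
  [set k | exists2 A : {fset nat}, is_basis h n [set` A] & k = #|` A|%fset].

Lemma basis_card_nonempty (h n : nat) : 0 < h -> exists k, basis_card h n k.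
Proof.
case: h => // h _; exists #|` [fset m in iota 0 n.+1]|%fset.
exists [fset m in iota 0 n.+1]%fset => // m /= le_mn.
exists (fun i : 'I_h.+1 => if i == ord0 then m else 0) => [i|] /=.
  by rewrite !inE; case: ifP => _ //; rewrite mem_iota; case: m le_mn.
by rewrite big_ord_recl /= big1 ?addn0.
Qed.

(* The junk value 0 is taken only when there is no h-basis of [0, n], which
   never happens for 0 < h. *)
Definition zeta (h n : nat) : nat :=
  if pselect (exists k, `[< basis_card h n k >]) is left exk then ex_minn exk
  else 0.

Lemma zetaP (h n : nat) : 0 < h ->
  basis_card h n (zeta h n) /\ forall k, basis_card h n k -> zeta h n <= k.
Proof.
move=> /basis_card_nonempty-/(_ n)[k0 bk0]; rewrite /zeta.
case: pselect => [exk|[]]; last by exists k0; apply/asboolP.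
by case: ex_minnP => m /asboolP bm minm; split=> // k /asboolP/minm.
Qed.

(* Main.v *)
(* Write x = n^(1/h) and h = h1 + 1 + h2 with h2 = floor (sqrt h). Let N be about
   n / x^h2. For k random elements of Z/N, the C(k, h1) sums over h1-subsets
   are pairwise independent enough that, by the second moment method, some
   choice produces at least M N / (M + N) distinct sums, where M = C(k, h1).
   As soon as M >= (1 + ln n) x^h1, greedily chosen translates by O(x) further
   elements turn this sumset into all of Z/N, and by Stirling k is about
   x (h1 / e) (1 + ln n)^(1/h1). Lifting Z/N to [0, N), the h2 remaining
   summands are N times the digits in base about x, which accounts for every
   m >= (h1 + 1) N; smaller m are written with h digits in base about
   x exp (- h2), which costs only O(x sqrt h) elements. When ln ln n > h the
   plain base-x digits, h (x + 1) elements, are already good enough. *)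
Require Import Defs.
From HB Require Import structures.
From mathcomp Require Import all_boot all_order all_algebra finmap.
From mathcomp Require Import all_classical all_reals all_analysis.
From mathcomp Require Import zify ring lra.

Set Implicit Arguments.
Unset Strict Implicit.
Unset Printing Implicit Defensive.

Import Order.TTheory GRing.Theory Num.Theory.
Import numFieldNormedType.Exports.

Local Open Scope nat_scope.

(** * Lists of summands and digit bases *)

Definition hsum (h : nat) (s : seq nat) (m : nat) : Prop :=
  exists t : seq nat, [/\ size t = h, {subset t <= s} & sumn t = m].

Lemma hsum_sub h s1 s2 m : {subset s1 <= s2} -> hsum h s1 m -> hsum h s2 m.
Proof. by move=> s12 [t [t1 t2 t3]]; exists t; split=> // x /t2/s12. Qed.

Lemma hsumD h1 h2 s m1 m2 :
  hsum h1 s m1 -> hsum h2 s m2 -> hsum (h1 + h2) s (m1 + m2).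
Proof.
move=> [t1 [<- ts1 <-]] [t2 [<- ts2 <-]]; exists (t1 ++ t2).
by split; rewrite ?size_cat ?sumn_cat // => x; rewrite mem_cat => /orP[/ts1|/ts2].
Qed.

Lemma sumnMl c (s : seq nat) : sumn [seq c * d | d <- s] = c * sumn s.
Proof. by elim: s => [|a s IHs] /=; rewrite ?muln0 // IHs mulnDr. Qed.

Lemma hsumM h c s m : hsum h s m -> hsum h [seq c * d | d <- s] (c * m).
Proof.
move=> [t [<- ts <-]]; exists [seq c * d | d <- t].
split; rewrite ?size_map ?sumnMl // => _ /mapP[x /ts xs ->].
exact: map_f.
Qed.

(** Duplicates in [s] are harmless: passing to the finite set of its entries can only lower the
    count. *)
Lemma zeta_le_size h n (s : seq nat) :
  0 < h -> (forall m, m <= n -> hsum h s m) -> zeta h n <= size s.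
Proof.
move=> h_gt0 bas; have [_ zmin] := zetaP n h_gt0.
pose A := [fset x in s]%fset.
apply: (@leq_trans #|` A|%fset).
  apply: zmin; exists A => // m /= /bas[t [th ts <-]].
  exists (fun i : 'I_h => nth 0 t i) => [i|].
    by rewrite /= inE; apply/ts/mem_nth; rewrite th.
  by rewrite sumnE (big_nth 0) th big_mkord.
by rewrite /A card_fseq size_undup.
Qed.

Definition digits (b h : nat) : seq nat :=
  [seq d * b ^ i | i <- iota 0 h, d <- iota 0 b].

Lemma size_digits b h : size (digits b h) = h * b.
Proof. by rewrite /digits size_allpairs !size_iota. Qed.

Lemma hsum_digits b h m : m < b ^ h -> hsum h (digits b h) m.
Proof.
elim: h m => [|h IHh] m.
  by rewrite expn0 ltnS leqn0 => /eqP->; exists [::].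
have [->|b_gt0] := posnP b; first by rewrite exp0n.
move=> m_lt; rewrite (divn_eq m (b ^ h)); apply: (@hsumD 1 h).
  exists [:: m %/ b ^ h * b ^ h]; split=> //=; last by rewrite addn0.
  move=> x; rewrite inE => /eqP->; apply/allpairsP; exists (h, m %/ b ^ h).
  split; rewrite ?mem_iota //= add0n.
  by rewrite ltn_divLR ?expn_gt0 ?b_gt0 // -expnS.
apply: hsum_sub (IHh (m %% b ^ h) _); last by rewrite ltn_mod expn_gt0 b_gt0.
move=> _ /allpairsP[[i d] /= [ih db ->]]; apply/allpairsP; exists (i, d).
split=> //; move: ih; rewrite !mem_iota !add0n => /andP[_ /ltnW ih] /=.
by rewrite ltnS.
Qed.

Lemma zeta_le_digits h n b : 0 < h -> n < b ^ h -> zeta h n <= h * b.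
Proof.
move=> h_gt0 n_lt; rewrite -size_digits; apply: zeta_le_size => // m mn.
by apply: hsum_digits; apply: leq_ltn_trans n_lt.
Qed.

(** * Distinct subset sums and greedy covering in a finite abelian group *)

(** Cauchy-Schwarz against the constant 1, by summing 2ab <= a^2 + b^2 over pairs. It turns a bound
    on collisions into many distinct sums. *)
Lemma sum_sqr_le (T : finType) (S : {set T}) (r : T -> nat) :
  (\sum_(g in S) r g) ^ 2 <= #|S| * \sum_(g in S) r g ^ 2.
Proof.
rewrite -(leq_pmul2l (isT : 0 < 2)).
have -> : 2 * (\sum_(g in S) r g) ^ 2 =
    \sum_(g in S) \sum_(f in S) 2 * (r g * r f).
  rewrite -mulnn big_distrlr /= big_distrr /=.
  by apply: eq_bigr => g _; rewrite big_distrr.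
have -> : 2 * (#|S| * \sum_(g in S) r g ^ 2) =
    \sum_(g in S) \sum_(f in S) (r g ^ 2 + r f ^ 2).
  under [RHS]eq_bigr do rewrite big_split /= sum_nat_const.
  by rewrite big_split /= -big_distrr /= sum_nat_const addnn mul2n.
by apply: leq_sum => g _; apply: leq_sum => f _; apply: nat_Cauchy.
Qed.

Local Open Scope ring_scope.

(* The coordinate i of a, which occurs only in the first sum, is determined by
   the others. *)
Lemma card_ffun_eq_sum (G : finZmodType) (k : nat) (I J : {set 'I_k}) (i : 'I_k) :
  i \in I -> i \notin J ->
  (#|[set a : {ffun 'I_k -> G} | (\sum_(l in I) a l == \sum_(l in J) a l)%R]|
    * #|G| = #|G| ^ k)%N.
Proof.
move=> iI iJ.
set E := [set a | _].
(* Adding an element of [G] at coordinate [i] changes the sum over [I] by that element and leaves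
   the sum over [J] alone, so [shift] maps [E] times [G] bijectively onto all functions. *)
pose shift (p : {ffun 'I_k -> G} * G) : {ffun 'I_k -> G} :=
  [ffun l => p.1 l + (if l == i then p.2 else 0)].
have shiftI p : \sum_(l in I) shift p l = \sum_(l in I) p.1 l + p.2.
  under eq_bigr do rewrite ffunE.
  rewrite big_split /= -big_mkcondr /=; congr (_ + _).
  rewrite (big_pred1 i) // => l /=.
  by rewrite andbC; case: eqP => // ->.
have shiftJ p : \sum_(l in J) shift p l = \sum_(l in J) p.1 l.
  apply: eq_bigr => l lJ; rewrite ffunE; case: eqP => [li|_]; last by rewrite addr0.
  by rewrite -li lJ in iJ.
have <- : #|[set shift p | p in finset.setX E [set: G]%SET]| = (#|E| * #|G|)%N.
  rewrite card_in_imset ?cardsX ?cardsT // => -[a g] [a' g'].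
  rewrite !inE !andbT /= => /eqP Ea /eqP Ea' eq_sh.
  have eqg : g = g'.
    move: (shiftI (a, g)) (shiftI (a', g')); rewrite eq_sh /= => ->.
    rewrite Ea Ea'; move: (shiftJ (a, g)) (shiftJ (a', g')); rewrite eq_sh /= => <- <-.
    by move/addrI.
  congr pair => //; apply/ffunP => l; move/ffunP: eq_sh => /(_ l).
  by rewrite !ffunE /= eqg => /addIr.
have -> : (#|G| ^ k)%N = #|[set: {ffun 'I_k -> G}]%SET|.
  by rewrite cardsT card_ffun card_ord.
apply: eq_card => a; rewrite inE; apply/imsetP.
pose g := \sum_(l in I) a l - \sum_(l in J) a l.
exists (shift (a, - g), g); last first.
  apply/ffunP => l; rewrite !ffunE /=; case: eqP; rewrite ?addr0 //.
  by rewrite addrNK.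
rewrite !inE andbT /=; apply/eqP.
by rewrite shiftI shiftJ /= /g opprB addrC subrK.
Qed.

Lemma exists_le_avg (T : finType) (F : T -> nat) (A B : nat) :
  (0 < #|T| -> (\sum_(t : T) F t) * A <= #|T| * B -> exists t, F t * A <= B)%N.
Proof.
move=> T_gt0 le_sum; apply: contrapT => noF.
have: (#|T| * B < (\sum_(t : T) F t) * A)%N.
  rewrite big_distrl /= -sum_nat_const.
  have [t0 _] := card_gt0P T_gt0.
  have ltF t : (B < F t * A)%N.
    by rewrite ltnNge; apply/negP => leF; apply: noF; exists t.
  rewrite (bigD1 t0) //= [ltnRHS](bigD1 t0) //= -addSn leq_add //.
  by apply: leq_sum => t _; apply: ltnW.
by rewrite ltnNge le_sum.
Qed.

(** For uniformly random [a], the expected number of ordered pairs of [h]-subsets with equal sums is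
    at most M + M^2 / |G|. For an [a] not above this average, Cauchy-Schwarz yields at least M^2 /
    (M + M^2 / |G|) distinct sums. *)
Lemma large_subset_sums (G : finZmodType) (k h : nat) :
  exists a : {ffun 'I_k -> G},
  let S := [set \sum_(l in I) a l | I : {set 'I_k} & #|I| == h]%SET in
  ('C(k, h) * #|G| <= #|S| * ('C(k, h) + #|G|))%N.
Proof.
set M := 'C(k, h).
pose Q := [set I : {set 'I_k} | #|I| == h].
have cardQ : #|Q| = M.
  by rewrite /Q /M -[k in RHS]card_ord -card_draws; apply: eq_card => I; rewrite !inE.
have G_gt0 : (0 < #|G|)%N by apply/card_gt0P; exists 0.
have [->|M_gt0] := posnP M; first by exists 0; rewrite mul0n.
pose coll (a : {ffun 'I_k -> G}) := (\sum_(I in Q) \sum_(J in Q)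
  (\sum_(l in I) a l == \sum_(l in J) a l)%R)%N.
have [a coll_a] : exists a, (coll a * #|G| <= M * #|G| + M * M)%N.
  apply: exists_le_avg; first by rewrite card_ffun card_ord expn_gt0 G_gt0.
  rewrite /coll exchange_big /=; under eq_bigr do rewrite exchange_big /=.
  rewrite big_distrl /= mulnDr mulnC !card_ffun card_ord.
  have -> : (M * #|G| * #|G| ^ k + #|G| ^ k * (M * M) =
      M * (#|G| ^ k * #|G| + M * #|G| ^ k))%N by ring.
  rewrite -cardQ -sum_nat_const.
  apply: leq_sum => I QI.
  rewrite big_distrl /= (bigD1 I) //= leq_add //.
    rewrite leq_mul2r; apply/orP; right.
    under eq_bigr do rewrite eqxx.
    by rewrite sum1_card card_ffun card_ord.
  rewrite -sum_nat_const [leqRHS](bigD1 I) //=.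
  apply: leq_trans (leq_addl _ _); apply: leq_sum => J /andP[QJ JI].
  (* Distinct sets of equal size: some index lies in [I] only, so the two sums agree for exactly a
     share 1 / |G| of all [a]. *)
  have /subsetPn[i iI iJ] : ~~ (I \subset J).
    apply/negP => sIJ; case/negP: JI; rewrite eq_sym eqEcard sIJ /=.
    by move: QI QJ; rewrite !inE => /eqP-> /eqP->.
  rewrite -(card_ffun_eq_sum G iI iJ) leq_mul2r; apply/orP; right.
  by rewrite -sum1dep_card [leqRHS]big_mkcond /= leq_sum // => a _; case: eqP.
exists a => S.
pose r g := #|[set I in Q | \sum_(l in I) a l == g]|.
have sumr : (\sum_(g in S) r g = M)%N.
  rewrite -cardQ -sum1_card (partition_big (fun I : {set 'I_k} => \sum_(l in I) a l) (mem S)) /=.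
    by apply: eq_bigr => g _; rewrite /r -sum1dep_card.
  by move=> I QI; apply/imsetP; exists I => //; move: QI; rewrite inE.
have sumr2 : (\sum_(g in S) r g ^ 2 = coll a)%N.
  rewrite /coll (partition_big (fun I : {set 'I_k} => \sum_(l in I) a l) (mem S)) /=; last first.
    by move=> I QI; apply/imsetP; exists I => //; move: QI; rewrite inE.
  apply: eq_bigr => g _.
  under eq_bigr => I /andP[_ /eqP->].
    rewrite (_ : (\sum_(J in Q) _)%N = r g); first over.
    rewrite /r -sum1dep_card [RHS]big_mkcondr /=.
    by apply: eq_bigr => J _; rewrite eq_sym; case: eqP.
  rewrite /= sum_nat_const -mulnn; congr (_ * _)%N.
  by apply: eq_card => I; rewrite [LHS]inE.
have := sum_sqr_le S r; rewrite sumr sumr2 => CS.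
rewrite -(leq_pmul2l M_gt0) mulnA mulnn.
apply: (@leq_trans (#|S| * coll a * #|G|)); first by rewrite leq_mul2r CS orbT.
by rewrite -mulnA [leqRHS]mulnCA leq_mul2l mulnDr addnC coll_a orbT.
Qed.

(** A random translate of [S] misses a given point with probability 1 - |S| / |G|, so some translate
    leaves at most that share of the uncovered set; this is iterated [c] times. *)
Lemma greedy_cover (G : finZmodType) (S : {set G}) (c : nat) :
  exists C : seq G, size C = c /\
  (#|[set u : G | ~~ has (fun g : G => (u - g)%R \in S) C]| * #|G| ^ c
    <= #|G| * (#|G| - #|S|) ^ c)%N.
Proof.
elim: c => [|c [C [sizeC leC]]].
  by exists [::]; split=> //; rewrite !expn0 !muln1 max_card.
set U := [set u | _] in leC.
have G_gt0 : (0 < #|G|)%N by apply/card_gt0P; exists 0.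
have [g leg] : exists g, (#|[set u in U | (u - g)%R \notin S]| * #|G|
    <= #|U| * (#|G| - #|S|))%N.
  apply: exists_le_avg => //.
  rewrite mulnC leq_mul2l; apply/orP; right.
  under eq_bigr do rewrite -sum1dep_card big_mkcondr /=.
  rewrite exchange_big /= -sum_nat_const leq_sum // => u _.
  rewrite -big_mkcond /= sum1dep_card -(cardsC S) addKn.
  rewrite -(card_imset (mem (finset.setC S)) (inv_inj (subKr u))) subset_leq_card //.
  apply/fintype.subsetP => g; rewrite inE => gS.
  by apply/imsetP; exists (u - g); rewrite ?inE ?subKr.
exists (g :: C); rewrite /= sizeC; split=> //.
rewrite (_ : #|_| = #|[set u in U | (u - g)%R \notin S]|); last first.
  by apply: eq_card => u; rewrite !inE negb_or andbC.
rewrite !expnS mulnA (leq_trans (leq_mul leg (leqnn _))) //.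
by rewrite mulnAC [leqRHS]mulnCA mulnC leq_mul2l leC orbT.
Qed.

(* From residues modulo N to integers *)
Local Close Scope ring_scope.
Local Open Scope nat_scope.

Lemma val_sum_ord p (J : Type) (s : seq J) (F : J -> 'I_p.+1) :
  (\sum_(j <- s) F j)%R = \sum_(j <- s) (F j : nat) %[mod p.+1].
Proof.
elim: s => [|j s IHs]; first by rewrite !big_nil.
by rewrite !big_cons /= modn_mod -modnDmr IHs modnDmr.
Qed.

(** The hypothesis makes the greedy residual less than 1, hence 0, for every sumset size that the
    second moment bound allows. The bound on [sumn t] later permits subtracting it from every large
    m. *)
Lemma residue_basis (N k h c : nat) :
  0 < N ->
  (forall s, s <= N -> 'C(k, h) * N <= s * ('C(k, h) + N) ->
     N * (N - s) ^ c < N ^ c) ->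
  exists s : seq nat, size s = k + c /\
  forall m, exists t, [/\ size t = h.+1, {subset t <= s}, sumn t = m %[mod N] &
                        sumn t <= h.+1 * N].
Proof.
case: N => // p _ large; pose G : finZmodType := 'I_p.+1.
have cardG : #|G| = p.+1 by rewrite card_ord.
have [a] := large_subset_sums G k h; set S := (X in let S := X in _) => /= leS.
have [C [sizeC]] := greedy_cover S c; set U := finset _ => leU.
have U0 : U = finset.set0.
  apply/eqP; rewrite -cards_eq0 -leqn0 -ltnS ltnNge; apply/negP => U1.
  have := large #|S|; rewrite -cardG max_card => /(_ isT leS).
  rewrite ltnNge => /negP; apply; apply: leq_trans leU.
  by rewrite leq_pmull.
exists ([seq nat_of_ord g | g <- codom a] ++ [seq nat_of_ord g | g <- C]).
split; first by rewrite size_cat 2!size_map sizeC size_codom card_ord.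
move=> m; have: (inZp m : G) \notin U by rewrite U0 inE.
rewrite inE negbK => /hasP[g gC /imsetP[I]]; rewrite inE => /eqP cardI eqg.
pose t := (g : nat) :: [seq (a l : nat) | l <- enum I].
have size_t : size t = h.+1 by rewrite /= size_map -cardE cardI.
exists t; split=> //.
- move=> x; rewrite inE mem_cat => /orP[/eqP->|/mapP[l _ ->]].
    by rewrite [X in _ || X]map_f ?orbT.
  by rewrite map_f // codom_f.
- have eqm : (inZp m = \sum_(l in I) a l + g :> G)%R by rewrite -eqg subrK.
  rewrite -[RHS]/(nat_of_ord (inZp m : G)) eqm.
  rewrite -[RHS]/((nat_of_ord (\sum_(l in I) a l)%R + g) %% p.+1) addnC /=.
  rewrite -[RHS]modnDmr -big_enum /= val_sum_ord modnDmr.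
  by rewrite sumnE big_map.
- have: all (fun x => x <= p.+1) t.
    by rewrite /= ltnW //=; apply/allP => _ /mapP[l _ ->]; apply: ltnW.
  rewrite -size_t; elim: (t) => //= x s IHs /andP[xp /IHs le_s].
  by rewrite mulSn leq_add.
Qed.

Lemma zeta_le_combined (h1 h2 n N k c b b' : nat) :
  0 < N -> n < N * b ^ h2 -> h1.+1 * N <= b' ^ (h1.+1 + h2) ->
  (forall s, s <= N -> 'C(k, h1) * N <= s * ('C(k, h1) + N) ->
     N * (N - s) ^ c < N ^ c) ->
  zeta (h1.+1 + h2) n <= k + c + h2 * b + (h1.+1 + h2) * b'.
Proof.
move=> N_gt0 ltn leb' large.
have [s [sizes resid]] := residue_basis N_gt0 large.
pose A := (s ++ [seq N * d | d <- digits b h2]) ++ digits b' (h1.+1 + h2).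
rewrite (_ : k + c + _ + _ = size A); last first.
  by rewrite /A 2!size_cat size_map !size_digits sizes.
apply: zeta_le_size => // m mn.
(* Below this threshold the sum representing the residue of [m] may exceed [m], hence the separate
   digits in base [b']. *)
have [m_lt|m_ge] := ltnP m (h1.+1 * N).
  apply: (hsum_sub (s1 := digits b' (h1.+1 + h2))).
    by move=> x xb'; rewrite mem_cat xb' orbT.
  by apply: hsum_digits; apply: leq_trans leb'.
have [t [sizet ts eqt let_]] := resid m.
have letm := leq_trans let_ m_ge.
have /dvdnP[j mj] : N %| m - sumn t by rewrite -eqn_mod_dvd //; apply/eqP.
rewrite -(subnKC letm) mj mulnC; apply: hsumD.
  by exists t; split=> // x /ts xs; rewrite !mem_cat xs.
apply: hsum_sub (hsumM N (hsum_digits (b := b) (h := h2) (m := j) _)).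
  by move=> x xs; rewrite !mem_cat xs orbT.
rewrite -(ltn_pmul2l N_gt0) mulnC -mj; apply: leq_ltn_trans ltn.
by apply: leq_trans mn; apply: leq_subr.
Qed.

(** * Stirling and exponential estimates *)

Local Open Scope classical_set_scope.
Local Open Scope ring_scope.

(** Stirling's upper bound up to a constant and a power of h. The induction step reduces to (1 -
    1/m)^m <= 1/e with m = [h.+2]. *)
Lemma fact_le_expR (R : realType) (h : nat) : (0 < h)%N ->
  h`!%:R <= expR 1 * h%:R * (h%:R / expR 1) ^+ h :> R.
Proof.
case: h => // h _; elim: h => [|h IHh].
  by rewrite expr1 mulr1 mul1r mulfV // gt_eqF // expR_gt0.
have e_gt0 := expR_gt0 (1 : R).
have h_gt0 : 0 < h.+1%:R :> R by rewrite ltr0n.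
have h2_gt0 : 0 < h.+2%:R :> R by rewrite ltr0n.
have step : (h.+1%:R / h.+2%:R) ^+ h.+2 <= (expR 1)^-1 :> R.
  rewrite -expRN (_ : -1 = h.+2%:R * - h.+2%:R^-1 :> R); last first.
    by rewrite mulrN mulfV // gt_eqF.
  rewrite expRM_natl lerXn2r ?nnegrE ?expR_ge0 ?divr_ge0 ?ler0n //.
  apply: le_trans (expR_ge1Dx _).
  rewrite -(ler_pM2r h2_gt0) mulfVK ?gt_eqF // mulrBl mul1r mulVf ?gt_eqF //.
  by rewrite -(natr1 h.+1) addrK.
rewrite factS natrM.
apply: le_trans (ler_wpM2l (ltW h2_gt0) IHh) _.
rewrite expr_div_n ler_pdivrMr ?exprn_gt0 // ler_pdivlMl // in step.
rewrite !expr_div_n -mulrA mulrCA -[leRHS]mulrA ler_pM2l // ler_pM2l //.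
rewrite mulrA -exprS [expR 1 ^+ h.+2]exprS invfM mulrA.
by rewrite ler_pM2r ?invr_gt0 ?exprn_gt0 // ler_pdivlMr // mulrC.
Qed.

Lemma expr_div_le_expR (R : realType) (N s c : R) (m : nat) :
  0 < N -> 0 <= s <= N -> c * N <= s * m%:R -> (N - s) ^+ m <= N ^+ m * expR (- c).
Proof.
move=> N_gt0 /andP[s_ge0 s_le] cN.
have le1 : N - s <= N * expR (- (s / N)).
  have := expR_ge1Dx (- (s / N)); rewrite -(ler_pM2l N_gt0); apply: le_trans.
  by rewrite mulrDr mulr1 mulrN mulrCA mulfV ?mulr1 ?gt_eqF.
apply: (@le_trans _ _ ((N * expR (- (s / N))) ^+ m)).
  by rewrite lerXn2r ?nnegrE ?subr_ge0 // mulr_ge0 ?expR_ge0 // ltW.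
rewrite exprMn -expRM_natr; apply: ler_wpM2l; first exact/exprn_ge0/ltW.
rewrite ler_expR.
by rewrite mulNr lerN2 -(ler_pM2r N_gt0) mulrAC mulfVK ?gt_eqF.
Qed.

Lemma expn_sub_le_ffact (k h : nat) : ((k - h) ^ h <= k ^_ h)%N.
Proof.
rewrite ffact_prod -[X in (_ ^ X)%N](card_ord h) -prod_nat_const.
by apply: leq_prod => i _; rewrite leq_sub2l // ltnW.
Qed.

(* Since s c >= N (L + 1), the residual N (1 - s / N)^c of the greedy covering
   is at most N exp (- L - 1) <= (n + 1) / (e n) < 1. *)
Lemma residual_lt_one (R : realType) (n M N b h s : nat) (x L : R) :
  (0 < N)%N -> (N <= n.+1)%N -> x <= b%:R -> 0 <= L <= x -> 1 <= x ->
  expR L = n%:R -> (2 <= n)%N ->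
  (L + 1) * x ^+ h <= M%:R -> N%:R <= 2 * x ^+ h.+1 ->
  (s <= N)%N -> (M * N <= s * (M + N))%N ->
  (N * (N - s) ^ (4 * b) < N ^ (4 * b))%N.
Proof.
move=> N_pos Nn xb /andP[L_ge0 Lx] x1 expL n_ge2 M_ge N_le sN Ms.
have N_gt0 : 0 < N%:R :> R by rewrite ltr0n.
have Lbound : (L + 1) * N%:R <= s%:R * (4 * b)%:R.
  have MN_gt0 : 0 < (M + N)%:R :> R by rewrite ltr0n addn_gt0 N_pos orbT.
  rewrite -(ler_pM2r MN_gt0) [leRHS]mulrAC -[X in _ <= X * _]natrM.
  apply: (@le_trans _ _ ((M * N)%N%:R * (4 * b)%N%:R)); last first.
    by rewrite ler_wpM2r ?ler0n // ler_nat.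
  rewrite !natrM natrD [leRHS]mulrAC [leLHS]mulrAC ler_pM2r //.
  (* What remains is (L + 1)(M + N) <= 4bM. Both halves are at most 2xM: the first by L + 1 <= 2x,
     the second by N <= 2x^(h+1) and (L + 1)x^h <= M. Hence the factor 4. *)
  have Mx : (L + 1) * x ^+ h * (2 * x) <= M%:R * (2 * x).
    by rewrite ler_wpM2r //; lra.
  have Nx : (L + 1) * N%:R <= (L + 1) * (2 * x ^+ h.+1).
    by rewrite ler_wpM2l //; lra.
  rewrite exprSr in Nx.
  have Mb : M%:R * (4 * x) <= M%:R * (4 * b%:R) by rewrite ler_wpM2l // ler_pM2l.
  have ML : M%:R * (L + 1) <= M%:R * (2 * x) by rewrite ler_wpM2l //; lra.
  lra.
rewrite -(ltr_nat R) natrM !natrX natrB //.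
apply: (@le_lt_trans _ _ (N%:R * (N%:R ^+ (4 * b) * expR (- (L + 1))))).
  by rewrite ler_pM2l // expr_div_le_expR // ler0n ler_nat.
rewrite mulrCA gtr_pMr ?exprn_gt0 // opprD expRD !expRN expL.
have n_gt0 : 0 < n%:R :> R by rewrite ltr0n ltnW.
rewrite mulrA ltr_pdivrMr ?expR_gt0 // ltr_pdivrMr // mul1r.
have n2 : 2 <= n%:R :> R by rewrite ler_nat.
apply: (@le_lt_trans _ _ (n%:R + 1)); first by rewrite natr1 ler_nat.
have e2 : n%:R * (1 + 1) <= n%:R * expR 1 :> R by rewrite ler_pM2l ?expR_ge1Dx.
by rewrite mulrC; apply: lt_le_trans e2; lra.
Qed.

(** * Choice of parameters *)

(** Here [L] is ln n, [y] governs the number [k] of random elements (its hypothesis gives C(k, h1)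
    >= (L + 1) x^h1), and [z] is the base used for small m. The term 4(x + 1) pays for the
    translates. *)
Lemma zeta_le_real (R : realType) (h1 h2 n : nat) (x L y z : R) :
  (2 <= n)%N -> x ^+ (h1.+1 + h2) = n%:R -> expR L = n%:R -> 1 <= x ->
  0 <= L <= x ->
  0 <= y -> (L + 1) * h1`!%:R * x ^+ h1 <= y ^+ h1 ->
  0 <= z -> 2 * h1.+1%:R * x ^+ h1.+1 <= z ^+ (h1.+1 + h2) ->
  (zeta (h1.+1 + h2) n)%:R <=
    h1%:R + y + 1 + 4 * (x + 1) + h2%:R * (x + 1) + (h1.+1 + h2)%:R * (z + 1).
Proof.
move=> n_ge2 xn expL x1 /andP[L_ge0 Lx] y_ge0 ley z_ge0 lez.
have x_gt0 : 0 < x by apply: lt_le_trans x1.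
(* Overshoots the usual ceiling by one at integers, still within t + 1 for t >= 0. *)
pose ceil (t : R) := (Num.truncn t).+1.
have ceil_ge t : t <= (ceil t)%:R by apply/ltW/truncnS_gt.
have ceil_le t : 0 <= t -> (ceil t)%:R <= t + 1.
  by move=> t0; rewrite /ceil -natr1 lerD2r truncn_le.
pose b := ceil x; pose N := (n %/ b ^ h2).+1; pose k := (h1 + ceil y)%N.
have b_ge : x <= b%:R := ceil_ge x.
have nN : (n < N * b ^ h2)%N by rewrite ltn_ceil // expn_gt0.
have N_le : N%:R <= x ^+ h1.+1 + 1.
  rewrite /N -natr1 lerD2r -(ler_pM2r (_ : 0 < x ^+ h2)) ?exprn_gt0 //.
  rewrite -exprD xn; apply: (@le_trans _ _ ((n %/ b ^ h2 * b ^ h2)%N)%:R).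
    by rewrite natrM ler_wpM2l ?ler0n // natrX lerXn2r ?nnegrE // ltW.
  by rewrite ler_nat leq_divM.
have N_le2 : N%:R <= 2 * x ^+ h1.+1.
  by apply: le_trans N_le _; rewrite mulr2n mulrDl mul1r lerD2l exprn_ege1.
have N_len : (N <= n.+1)%N by rewrite ltnS leq_div.
have L_bnd : 0 <= L <= x by rewrite L_ge0.
set M := 'C(k, h1).
have M_ge : (L + 1) * x ^+ h1 <= M%:R.
  have f_gt0 : 0 < h1`!%:R :> R by rewrite ltr0n fact_gt0.
  rewrite -(ler_pM2r f_gt0) mulrAC -natrM bin_ffact; apply: le_trans ley _.
  apply: (@le_trans _ _ (((k - h1) ^ h1)%N)%:R); last first.
    by rewrite ler_nat expn_sub_le_ffact.
  by rewrite /k addKn natrX lerXn2r ?nnegrE.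
have large (s : nat) : (s <= N)%N -> (M * N <= s * (M + N))%N ->
    (N * (N - s) ^ (4 * b) < N ^ (4 * b))%N.
  exact: (residual_lt_one (isT : (0 < N)%N) N_len b_ge L_bnd x1 expL n_ge2 M_ge N_le2).
have leb' : (h1.+1 * N <= ceil z ^ (h1.+1 + h2))%N.
  rewrite -(ler_nat R) natrM natrX.
  apply: (@le_trans _ _ (z ^+ (h1.+1 + h2))); last by rewrite lerXn2r ?nnegrE.
  apply: le_trans lez; by rewrite -mulrA [leRHS]mulrCA ler_wpM2l ?ler0n.
have := zeta_le_combined (isT : (0 < N)%N) nN leb' large.
rewrite -(ler_nat R) => /le_trans; apply.
rewrite /k !natrD !natrM.
have := ceil_le _ y_ge0; have := ceil_le _ z_ge0; have := ceil_le _ (ltW x_gt0).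
rewrite -/b => bx zz yy.
have := ler_wpM2l (ler0n R h2) bx.
have := ler_wpM2l (ler0n R (h1.+1 + h2)) zz.
rewrite natrD; lra.
Qed.

Lemma zeta_le_trivial (R : realType) (h n : nat) (x : R) :
  (0 < h)%N -> 0 <= x -> x ^+ h = n%:R -> (zeta h n)%:R <= h%:R * (x + 1).
Proof.
move=> h_gt0 x_ge0 xn; pose b := (Num.truncn x).+1.
have nb : (n < b ^ h)%N.
  by rewrite -(ltr_nat R) -xn natrX ltrXn2r ?nnegrE ?truncnS_gt // -?lt0n.
have := zeta_le_digits h_gt0 nb; rewrite -(ler_nat R) natrM => /le_trans; apply.
by rewrite ler_wpM2l // /b -natr1 lerD2r truncn_le.
Qed.

(** Uses e^u - 1 <= u e^u and e^(u-1) <= 2; the latter follows from e^(1-u) >= 2 - u >= 1/2, which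
    is where 3/2 enters. The resulting factor 2 becomes the coefficient of ln ln n. *)
Lemma mulr_expR_le (R : realType) (a u : R) :
  0 <= a -> 0 <= u <= 3 / 2 -> a / expR 1 * expR u <= a / expR 1 + 2 * (a * u).
Proof.
move=> a_ge0 /andP[u_ge0 u_le].
have eN : 1 - u <= expR (- u) by exact: expR_ge1Dx.
have e1 : expR u - 1 <= u * expR u.
  have := ler_wpM2r (expR_ge0 u) eN.
  by rewrite mulrBl mul1r -expRD addNr expR0; lra.
have e2 : expR u / expR 1 <= 2.
  rewrite -expRN -expRD.
  have -> : 2 = (2^-1)^-1 :> R by rewrite invrK.
  rewrite -[X in expR X]opprK expRN lef_pV2 ?posrE ?expR_gt0 //.
  by have := expR_ge1Dx (- (u - 1)); lra.
have e3 : (expR u - 1) / expR 1 <= u * 2.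
  apply: le_trans (ler_wpM2r _ e1) _; first by rewrite invr_ge0 expR_ge0.
  by rewrite -mulrA ler_wpM2l.
have := ler_wpM2l a_ge0 e3.
have -> : a / expR 1 * expR u = a * ((expR u - 1) / expR 1) + a / expR 1 by ring.
lra.
Qed.

Lemma zeta_le_large (R : realType) (h n : nat) (L x s : R) :
  s ^+ 2 = h%:R -> 8 <= s -> h%:R ^+ 2 <= L -> ln L <= h%:R ->
  expR L = n%:R -> x = expR (L / h%:R) ->
  (zeta h n)%:R <= x * (h%:R / expR 1 + 2 * ln L + 24 * s).
Proof.
move=> sh s8 hL lnL expL xE.
have hs : 64 <= h%:R :> R by rewrite -sh; nra.
have h_gt0 : 0 < h%:R :> R by lra.
have L1 : 1 <= L by apply: le_trans hL; nra.
have L_gt0 : 0 < L by lra.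
have Lh : h%:R <= L / h%:R by rewrite ler_pdivlMr // -expr2.
have x_ge : expR h%:R <= x by rewrite xE ler_expR.
have hx : h%:R + 1 <= x by apply: le_trans x_ge; rewrite addrC expR_ge1Dx.
have Lx : L <= x by apply: le_trans x_ge; rewrite -(ler_expR (ln L)) lnK in lnL.
have xn : x ^+ h = n%:R by rewrite xE -expRM_natr mulfVK // gt_eqF.
have n_ge2 : (2 <= n)%N.
  by rewrite -(ler_nat R) -expL; have := expR_ge1Dx L; lra.
pose h2 := Num.truncn s.
have /andP[h2s sh2] : h2%:R <= s < h2%:R + 1 by rewrite natr1 truncn_itv //; lra.
have h2h : (h2.+1 < h)%N by rewrite -(ltr_nat R) -natr1; nra.
pose h1 := (h - h2.+1)%N.
have hE : h = (h1.+1 + h2)%N by rewrite /h1; lia.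
have h1E : h1%:R = h%:R - 1 - h2%:R :> R by rewrite hE natrD -natr1; lra.
have h1_gt0 : 0 < h1%:R :> R by rewrite h1E; nra.
(* Chosen so that e^(h1 u) = (L + 1) e h1, absorbing both the logarithmic factor and the excess
   factor e h1 of Stirling's bound. *)
pose u := (ln (L + 1) + 1 + ln h1%:R) / h1%:R.
have h1u : h1%:R * u = ln (L + 1) + 1 + ln h1%:R by rewrite /u mulrCA mulfV ?mulr1 // gt_eqF.
have lnL1 : ln (L + 1) <= ln L + 1.
  rewrite -[leRHS]expRK ler_ln ?posrE ?expR_gt0 //; last by lra.
  rewrite expRD lnK //; have := expR_ge1Dx (1 : R); nra.
have lns : ln s <= s by apply/ltW/ln_sublinear; lra.
have lnh1 : ln h1%:R <= 2 * s.
  apply: (@le_trans _ _ (ln (s ^+ 2))); last by rewrite lnXn ?mulr2n; lra.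
  by rewrite ler_ln ?posrE // sh // h1E; have := ler0n R h2; lra.
have u_bnd : 0 <= u <= 3 / 2.
  apply/andP; split.
    by rewrite /u divr_ge0 ?ler0n // !addr_ge0 ?ln_ge0 //; [lra|rewrite ler1n -(ltr0n R)].
  (* With numerator at most s^2 + 2s + 2 and denominator at least s^2 - s - 1, this amounts to s^2
     >= 7s + 7, which holds from s = 8 on. *)
  rewrite /u ler_pdivrMr //.
  have : h1%:R >= s ^+ 2 - 1 - s by rewrite h1E sh; lra.
  nra.
pose y := x * (h1%:R / expR 1 * expR u).
have x_gt0 : 0 < x by lra.
have e_gt0 := expR_gt0 (1 : R).
have y_ge0 : 0 <= y by rewrite /y !mulr_ge0 ?expR_ge0 ?invr_ge0 ?expR_ge0 // ltW.
have y_pow : (L + 1) * h1`!%:R * x ^+ h1 <= y ^+ h1.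
  rewrite /y exprMn mulrC ler_wpM2l ?exprn_ge0 ?(ltW x_gt0) //.
  rewrite exprMn -expRM_natl h1u !expRD !lnK ?posrE //; last by lra.
  rewrite -mulrA [leRHS]mulrCA; apply: ler_wpM2l; first by lra.
  by rewrite mulrC fact_le_expR // -(ltr0n R).
(* Then e^(-th) = x^(-h2), so z^h = 2^h x^(h1+1), and 2^h dominates 2(h1 + 1) because h2 >= 1. *)
pose t := L / h%:R * h2%:R / h%:R.
pose z := 2 * x * expR (- t).
have z_ge0 : 0 <= z by rewrite /z !mulr_ge0 ?expR_ge0 // ltW.
have z_pow : 2 * h1.+1%:R * x ^+ h1.+1 <= z ^+ h.
  rewrite /z !exprMn -[expR (- t) ^+ h]expRM_natr.
  have -> : - t * h%:R = - (L / h%:R * h2%:R) by rewrite /t mulNr mulfVK // gt_eqF.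
  rewrite [in x ^+ h]hE exprD expRN expRM_natr -xE.
  rewrite -!mulrA mulfV ?gt_eqF ?exprn_gt0 // mulr1 mulrA ler_wpM2r ?exprn_ge0 ?(ltW x_gt0) //.
  rewrite -natrX -natrM ler_nat.
  apply: (@leq_trans (2 ^ h1.+2)); first by rewrite expnS leq_mul2l ltnW // ltn_expl.
  by rewrite leq_exp2l // hE -addn1 leq_add2l truncn_gt0; lra.
(* Since L >= h^2 gives t >= h2, one has e^t >= 1 + h2 > s; the h digits in base about [z] thus cost
   only O(s x). *)
have z_le : z <= 2 * x / s.
  rewrite /z; apply: ler_wpM2l; first by rewrite mulr_ge0 // ltW.
  rewrite expRN lef_pV2 ?posrE ?expR_gt0 //; last by lra.
  apply: le_trans (expR_ge1Dx _); rewrite addrC.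
  have : h2%:R <= t; last by lra.
  by rewrite /t ler_pdivlMr // mulrC ler_wpM2r.
have hz : h%:R * z <= 2 * s * x.
  apply: (le_trans (ler_wpM2l (ltW h_gt0) z_le)).
  rewrite -sh; have -> : s ^+ 2 * (2 * x / s) = 2 * s * x.
    by field; rewrite gt_eqF //; lra.
  by [].
have := @zeta_le_real R h1 h2 n x L y z n_ge2.
rewrite -hE => /(_ xn expL _ _ y_ge0 y_pow z_ge0 z_pow) bound.
apply: le_trans (bound _ _) _; [by lra|by apply/andP; split; lra|].
have y_le : y <= x * (h%:R / expR 1 + 2 * (ln L + 2 + 2 * s)).
  rewrite /y ler_pM2l //; apply: (le_trans (mulr_expR_le (ltW h1_gt0) u_bnd)).
  rewrite lerD //; last by rewrite h1u; lra.
  by rewrite ler_wpM2r ?invr_ge0 ?expR_ge0 // h1E; have := ler0n R h2; lra.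
have h2x : h2%:R * (x + 1) <= s * (x + x) by apply: ler_pM => //; lra.
have h1x : h1%:R + 1 <= x by rewrite h1E; have := ler0n R h2; lra.
have sx : x * 8 <= x * s by rewrite ler_pM2l.
(* Of the 24 s, 4 s comes from [y]; the other costs are O(x) or O(s x), and 8 <= s converts the
   former into the latter. *)
have -> : x * (h%:R / expR 1 + 2 * ln L + 24 * s) =
  x * (h%:R / expR 1 + 2 * (ln L + 2 + 2 * s)) + 20 * (x * s) - 4 * x by ring.
nra.
Qed.

(** * The error term and the conclusion *)

Lemma cvg_sqrt_div (R : realType) (C : R) :
  (fun h : nat => C * Num.sqrt h%:R / h%:R) @ \oo --> (0 : R).
Proof.
apply/cvgrPdist_lt => e e_gt0; near=> h.
have h_gt0 : 0 < h%:R :> R by rewrite ltr0n; near: h; exact: nbhs_infty_gt.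
have s_gt0 : 0 < Num.sqrt h%:R :> R by rewrite sqrtr_gt0.
rewrite sub0r normrN.
have -> : C * Num.sqrt h%:R / h%:R = C / Num.sqrt h%:R.
  by rewrite -{2}(sqr_sqrtr (ltW h_gt0)); field; rewrite gt_eqF.
rewrite normrM normfV (gtr0_norm s_gt0) ltr_pdivrMr // mulrC -ltr_pdivrMr //.
rewrite -(ltr_pXn2r (_ : 0 < 2)%N) ?nnegrE ?divr_ge0 ?(ltW e_gt0) ?(ltW s_gt0) //.
rewrite sqr_sqrtr ?ler0n //.
near: h; exact: nbhs_infty_gtr.
Unshelve. all: by end_near. Qed.

Theorem theorem1 (R : realType) :
  exists eps : nat -> R,
    ((fun h : nat => eps h / h%:R) @ \oo --> (0 : R)) /\
    forall h n : nat, (0 < h)%N -> (0 < n)%N ->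
      expR (h%:R ^+ 2) <= n%:R :> R ->
      (zeta h n)%:R <=
        n%:R `^ (h%:R^-1) *
        (h%:R / expR 1 + 232%:R / 100%:R * ln (ln n%:R) + eps h).
Proof.
exists (fun h => 24 * Num.sqrt h%:R); split; first exact: cvg_sqrt_div.
move=> h n h_gt0 n_gt0 hn.
set s := Num.sqrt _; set L := ln n%:R.
have n0 : 0 < n%:R :> R by rewrite ltr0n.
have h1 : 1 <= h%:R :> R by rewrite ler1n.
have expL : expR L = n%:R by rewrite /L lnK.
have hL : h%:R ^+ 2 <= L by rewrite -ler_expR expL.
have L1 : 1 <= L by apply: le_trans hL; nra.
have sh : s ^+ 2 = h%:R by rewrite sqr_sqrtr ?ler0n.
have s1 : 1 <= s by rewrite -[1]sqrtr1 ler_wsqrtr.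
have -> : n%:R `^ h%:R^-1 = expR (L / h%:R).
  by rewrite /powR gt_eqF // mulrC.
set x := expR _.
have hx : h%:R + 1 <= x.
  rewrite addrC; apply: le_trans (expR_ge1Dx _) _; rewrite ler_expR.
  by rewrite ler_pdivlMr -?expr2 //; lra.
have x_gt0 : 0 < x by lra.
have xn : x ^+ h = n%:R by rewrite -expRM_natr mulfVK // gt_eqF //; lra.
have l_ge0 : 0 <= ln L by rewrite ln_ge0.
have he : 0 <= h%:R / expR 1 :> R by rewrite divr_ge0 ?expR_ge0.
have triv : (zeta h n)%:R <= x * (h%:R + 1).
  apply: le_trans (zeta_le_trivial h_gt0 (ltW x_gt0) xn) _.
  by rewrite mulrDr mulrC mulr1; nra.
(* For s < 8 the error term alone suffices: h + 1 = s^2 + 1 <= 24 s. *)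
have [s8|s8] := leP 8 s; last first.
  apply: le_trans triv _; rewrite ler_pM2l // -sh.
  nra.
(* If ln ln n > h, then h + 1 is below ln ln n + 24 s. *)
have [lL|lL] := leP (ln L) h%:R; last first.
  apply: le_trans triv _; rewrite ler_pM2l //.
  lra.
apply: le_trans (zeta_le_large sh s8 hL lL expL (erefl x)) _.
rewrite ler_pM2l //; lra.
Qed.
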